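(* Let $G=\theta_{d_1,\dots,d_\ell}$ be a generalized theta graph with $\ell\ge1$ paths and $d_i\ge1$ for all $i$. Then Broadcast is solvable on $G$ with $k$ ignorant agents for every $k\ge \ell$ (with $k+1$ not exceeding the number of nodes of $G$).
   Context: Generalized theta graph: $\theta_{d_1,\dots,d_\ell}$ consists of two distinct fixed nodes $N,S$ (the poles) joined by $\ell$ internally vertex-disjoint paths, the $i$-th of which has exactly $d_i\ge 1$ internal nodes. Broadcast model: a connected base graph $G=(V,E)$ with $n$ nodes. There is one source agent holding a message $\mathcal M$ and $k\ge1$ ignorant agents (agents not holding $\mathcal M$); initially all agents occupy pairwise distinct nodes, the initial placement being chosen by the adversary. Time proceeds in synchronous rounds; in each round: (1) the adversary removes a (possibly empty) set $E'\subseteq E$ of edges such that $(V,E\setminus E')$ is connected; (2) each agent (agents have unique IDs, local memory, and see the entire current graph, the positions of all agents and which agents hold $\mathcal M$) chooses either to stay or to traverse an edge of $E\setminus E'$ incident to its current node; (3) agents move. Whenever an ignorant agent is at the same node as an agent holding $\mathcal M$, it receives $\mathcal M$ and becomes a source agent. The adversary is adaptive and knows the agents' strategy. Broadcast is solvable on $G$ with $k$ ignorant agents if the agents have a strategy such that, for every initial placement and every adversary behaviour, after finitely many rounds all agents hold $\mathcal M$; otherwise the adversary is said to have a winning strategy. *)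

(* Defs.v *)
From mathcomp Require Import all_boot.
Set Implicit Arguments. Unset Strict Implicit. Unset Printing Implicit Defensive.

(** * Generalized theta graph theta_{d_1,...,d_l}
    Nodes: the two poles N (= inl true) and S (= inl false), and the internal
    node number j (0 <= j < d i) of the i-th path (= inr (existT i j)).
    Path i is  N - (i,0) - (i,1) - ... - (i, d i - 1) - S. *)
Definition thnode (l : nat) (d : 'I_l -> nat) : finType :=
  (bool + {i : 'I_l & 'I_(d i)})%type.

Definition theta_arc (l : nat) (d : 'I_l -> nat) (x y : thnode d) : bool :=
  match x, y with
  | inl true, inr p => nat_of_ord (tagged p) == 0
  | inr p, inl false => (nat_of_ord (tagged p)).+1 == d (tag p)
  | inr p, inr q => (tag p == tag q) && ((nat_of_ord (tagged p)).+1 == nat_of_ord (tagged q))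
  | _, _ => false
  end.

Definition theta_adj (l : nat) (d : 'I_l -> nat) : rel (thnode d) :=
  fun x y => theta_arc x y || theta_arc y x.

(** agents: 'I_k.+1; agent ord0 is the source, the other k are ignorant *)
Definition agent (k : nat) := 'I_k.+1.

(** The graph the adversary leaves in a round: a symmetric sub-relation of the
    base edges (i.e. E \ E') that is connected. *)
Definition valid_round_graph (V : finType) (adj : rel V) (H : rel V) : Prop :=
  (forall x y, H x y -> adj x y) /\ symmetric H /\ (forall x y, connect H x y).

Definition legal_move (V : finType) (H : rel V) (x x' : V) : bool :=
  (x' == x) || H x x'.

(** A (deterministic, full-information) joint strategy of the agents: given the
    initial placement and the sequence of graphs observed so far (including the
    current round's graph), it returns the node each agent goes to. *)
Definition strategy (V : finType) (k : nat) :=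
  (agent k -> V) -> seq (rel V) -> agent k -> V.

Definition positions (V : finType) (k : nat) (st : strategy V k)
  (p0 : agent k -> V) (A : nat -> rel V) (t : nat) : agent k -> V :=
  match t with
  | 0 => p0
  | t'.+1 => st p0 (mkseq A t'.+1)
  end.

Fixpoint informed (V : finType) (k : nat) (st : strategy V k)
  (p0 : agent k -> V) (A : nat -> rel V) (t : nat) : {set agent k} :=
  match t with
  | 0 => [set ord0]
  | t'.+1 =>
      let I := informed st p0 A t' in
      let p := positions st p0 A t'.+1 in
      [set a | (a \in I) || [exists b, (b \in I) && (p b == p a)]]
  end.

(** Broadcast is solvable on (V, adj) with k ignorant agents.  Since the
    strategy is deterministic and the adversary knows it, an adaptive
    adversary amounts to an arbitrary sequence of valid round graphs. *)
Definition broadcast_solvable (V : finType) (adj : rel V) (k : nat) : Prop :=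
  exists st : strategy V k,
    forall p0 : agent k -> V, injective p0 ->
    forall A : nat -> rel V, (forall t, valid_round_graph adj (A t)) ->
      (forall t (a : agent k),
          legal_move (A t) (positions st p0 A t a) (positions st p0 A t.+1 a))
      /\ exists t, forall a : agent k, a \in informed st p0 A t.

(* Main.v *)
Require Import Defs.
From mathcomp Require Import all_boot.
From mathcomp Require Import zify.
From mathcomp Require Import boolp.
Set Implicit Arguments. Unset Strict Implicit. Unset Printing Implicit Defensive.

(** Connectivity means that in every round each path misses at most one edge and
    some path misses none. Colour the agents by whether they hold the message;
    it suffices to force two agents of different colours to meet, whatever the
    current placement, and to repeat.

    Suppose that every path has an interior agent and that a pole [b] is held by
    an agent [z]. Let the agent of an uncut path walk towards [b] if its colour
    differs from that of [z], and towards the other pole otherwise. Either it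
    meets [z], or both poles end up held by the colour of [z] while some path has
    an agent of the other colour in between; the two agents around it then close
    in on it, since at most one of them is blocked at a time.

    To reach such a placement, first drive all but one agent of each path to the
    poles. If no path is empty, a pole is held because there are more than [l]
    agents. Otherwise at least two agents are at the poles. If both poles are
    held, an empty path can be entered from one of its ends. If all of them are
    at one pole, an uncut path is either empty, and can be entered, or its agent
    is pushed towards the other pole. *)

(** * Theta graphs: heights along a path, and the edges that connectivity preserves *)

Section ThetaGraph.

Variables (l : nat) (d : 'I_l -> nat).
Implicit Types (i : 'I_l) (b : bool) (x y : thnode d) (H : rel (thnode d)).

(** Every height above [d i] falls on the pole S, so heights are plain naturals. *)
Definition node i (h : nat) : thnode d :=
  if h is j.+1 then
    if insub j is Some o then inr (Tagged (fun i => 'I_(d i)) (o : 'I_(d i)))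
    else inl false
  else inl true.

(* Height [h] on path [i], counted from pole [b]; meaningful for [h <= (d i).+1]. *)
Definition pos b i h : thnode d := node i (if b then h else (d i).+1 - h).

Definition path_of x : option 'I_l := if x is inr q then Some (tag q) else None.

Lemma node_inr (q : {i : 'I_l & 'I_(d i)}) : inr q = node (tag q) (tagged q).+1.
Proof. by case: q => i j /=; rewrite valK. Qed.

Lemma node_top i : node i (d i).+1 = inl false.
Proof. by rewrite /= insubF // ltnn. Qed.

Lemma pos0 b i : pos b i 0 = inl b.
Proof. by case: b => //; rewrite /pos subn0 node_top. Qed.

Lemma pos_top b i : pos b i (d i).+1 = inl (~~ b).
Proof. by case: b; rewrite /pos ?subnn // node_top. Qed.

Lemma path_of_pos b i h : 0 < h <= d i -> path_of (pos b i h) = Some i.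
Proof.
have E j : 0 < j <= d i -> path_of (node i j) = Some i.
  by case: j => // j /= jd; rewrite insubT.
by move=> hd; apply: E; case: b; lia.
Qed.

Lemma path_of_Some b x i :
  path_of x = Some i -> exists2 h, 0 < h <= d i & x = pos b i h.
Proof.
case: x => // -[i' j] [<-] {i} /=; have jd := ltn_ord j.
have -> : inr (Tagged (fun i => 'I_(d i)) j) = node i' j.+1 := node_inr _.
move: (nat_of_ord j) jd => h hd.
exists (if b then h.+1 else d i' - h); first by case: b; lia.
by case: b; rewrite /pos //; congr node; lia.
Qed.

Lemma path_of_None x : path_of x = None -> x = inl true \/ x = inl false.
Proof. by case: x => [[]|] //; [left | right]. Qed.

Lemma theta_arcP x y : theta_arc x y ->
  exists i h, [/\ h <= d i, x = node i h & y = node i h.+1].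
Proof.
case: x y => [[]|q] [[]|r] //=.
- move=> /eqP r0; exists (tag r), 0; split=> //.
  by rewrite node_inr r0.
- move=> /eqP qd; exists (tag q), (tagged q).+1; split; first by rewrite qd.
    exact: node_inr.
  by rewrite qd; apply/esym/node_top.
case: q r => [i j] [i' j'] /= /andP[/eqP ii' /eqP jj']; subst i'.
exists i, j.+1; split; [exact: ltn_ord | exact: (node_inr (Tagged (fun i => 'I_(d i)) j))|].
by rewrite jj'; exact: (node_inr (Tagged (fun i => 'I_(d i)) j')).
Qed.

Lemma closed_theta H (m : pred (thnode d)) :
  valid_round_graph (@theta_adj l d) H ->
  (forall i h, h <= d i -> H (node i h) (node i h.+1) ->
     m (node i h) = m (node i h.+1)) ->
  forall x y, m x = m y.
Proof.
case=> Hadj [Hsym Hcon] mH x y.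
apply: (@closed_connect _ H m) (Hcon x y) => u v Huv; rewrite !unfold_in.
have /orP[] := Hadj _ _ Huv => /theta_arcP[i [h [hd Eu Ev]]].
  by rewrite Eu Ev in Huv *; apply: mH.
by rewrite Eu Ev Hsym in Huv *; apply/esym/mH.
Qed.

(** With both edges missing, the segment at heights [h + 1] to [h'] would be cut off from the
    rest. *)
Lemma node_edge2 H i h h' : valid_round_graph (@theta_adj l d) H ->
  h < h' <= d i -> H (node i h) (node i h.+1) || H (node i h') (node i h'.+1).
Proof.
move=> HV /andP[hh' h'd]; apply/norP => -[nh nh'].
pose m x := if x is inr q then (tag q == i) && (h <= tagged q < h') else false.
have mE i' j : j <= (d i').+1 -> m (node i' j) = (i' == i) && (h < j <= h').
  case: j => [|j] jd /=; first by rewrite andbF.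
  case: insubP => [o /= _ <- //|] /=.
  by case: eqP => // ii'; subst i'; lia.
suff: m (node i h') = m (inl true) by rewrite mE ?eqxx ?hh' ?leqnn // ltnW.
apply: (closed_theta HV) => i' j jd Hj; rewrite !mE //; last by lia.
case: eqP => //= ii'; subst i'.
have jh : j <> h by move=> E; rewrite -E Hj in nh.
have jh' : j <> h' by move=> E; rewrite -E Hj in nh'.
by lia.
Qed.

Lemma pos_edge2 H b i h h' : valid_round_graph (@theta_adj l d) H ->
  h < h' <= d i ->
  H (pos b i h) (pos b i h.+1) || H (pos b i h'.+1) (pos b i h').
Proof.
move=> HV hh'; have Hs := HV.2.1; case: b; rewrite /pos.
  by rewrite [X in _ || X]Hs; apply: node_edge2.
rewrite !subSS !subSn; try lia.
by rewrite orbC [X in _ || X]Hs; apply: node_edge2 => //; lia.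
Qed.

(** Otherwise pick a missing edge on each path: the nodes before these edges form a side containing
    N but not S. *)
Lemma uncut_path H : valid_round_graph (@theta_adj l d) H ->
  exists i, forall b h, h <= d i -> H (pos b i h) (pos b i h.+1).
Proof.
move=> HV; have Hs := HV.2.1.
pose ok i := [forall h : 'I_(d i).+1, H (node i h) (node i h.+1)].
case: (pickP ok) => [i /forallP oki|nok].
  have E h : h <= d i -> H (node i h) (node i h.+1).
    by move=> hd; exact: (oki (Ordinal (hd : h < (d i).+1))).
  exists i => -[] h hd; rewrite /pos; first exact: E.
  by rewrite Hs subSS subSn //; apply: E; lia.
have cP i : exists c : 'I_(d i).+1, ~~ H (node i c) (node i c.+1).
  by apply/existsP; rewrite -negb_forall; apply/negbT/nok.
pose c i := xchoose (cP i).
pose m x := match x with inl b => b | inr q => tagged q < c (tag q) end.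
have mE i j : j <= (d i).+1 -> m (node i j) = (j <= c i).
  case: j => [|j] jd //=; have := ltn_ord (c i) => cd.
  by case: insubP => [o /= _ <- //|] /=; lia.
suff: m (inl true) = m (inl false) by [].
apply: (closed_theta HV) => i j jd Hj; rewrite !mE //; last by lia.
have jc : j <> c i by move=> E; have := xchooseP (cP i); rewrite -E Hj.
by lia.
Qed.

End ThetaGraph.

Arguments node {l d}.
Arguments pos {l d}.

(** * The game of forcing two agents of different colours to meet *)

Section ForcedMeeting.

Variables (l : nat) (d : 'I_l -> nat) (T : finType) (c : T -> bool).
Hypothesis l_gt0 : 0 < l.
Hypothesis d_gt0 : forall i, 0 < d i.

Implicit Types (p : T -> thnode d) (b : bool) (i j : 'I_l) (u v z : T).

Let valid := valid_round_graph (@theta_adj l d).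

(** Being inductive rules out infinite plays. The colouring stays fixed until the first meeting. *)
Inductive forced (p : T -> thnode d) : Prop :=
| forced_meet u v of c u != c v & p u = p v
| forced_step of (forall H, valid H ->
    exists2 p' : T -> thnode d,
      (forall a, legal_move H (p a) (p' a)) & forced p').

(** The recursive occurrence sits under [exists2], so the induction principle is built by a nested
    fixpoint. *)
Lemma forced_elim (P : (T -> thnode d) -> Prop) :
  (forall p u v, c u != c v -> p u = p v -> P p) ->
  (forall p, (forall H, valid H ->
     exists2 p' : T -> thnode d,
       (forall a, legal_move H (p a) (p' a)) & P p') -> P p) ->
  forall p, forced p -> P p.
Proof.
move=> Pmeet Pstep; fix IH 2 => p [u v|step]; first exact: Pmeet.
apply: Pstep => H /step[p' leg fp']; exists p' => //; exact: IH.
Qed.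

Definition upd p u x : T -> thnode d := fun v => if v == u then x else p v.

Lemma upd_same p u x : upd p u x u = x.
Proof. by rewrite /upd eqxx. Qed.

Lemma upd_other p u x v : v != u -> upd p u x v = p v.
Proof. by rewrite /upd => /negPf->. Qed.

Lemma forced_move p :
  (forall H, valid H -> exists u x, H (p u) x /\ forced (upd p u x)) -> forced p.
Proof.
move=> mv; apply: forced_step => H /mv[u [x [Hx fx]]]; exists (upd p u x) => // a.
by rewrite /legal_move /upd; have [->|_] := eqVneq a u; rewrite ?Hx ?orbT ?eqxx.
Qed.

(* A path loses at most one edge per round, so one of the two outer agents can
   always approach the middle one. *)
Lemma forced_sandwich p b i u v w hu hv hw :
  p u = pos b i hu -> p v = pos b i hv -> p w = pos b i hw ->
  hu <= hv <= hw -> hw <= (d i).+1 -> u != w -> c u != c v -> c w != c v ->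
  forced p.
Proof.
move=> pu pv pw huvw hwd uw cuv cwv.
have uv : u != v by apply: contraNneq cuv => ->.
have wv : w != v by apply: contraNneq cwv => ->.
have [n] := ubnP (hw - hu); elim: n => // n IH in p hu hw pu pv pw huvw hwd *.
move=> hn; have [E|huv] := eqVneq hu hv.
  by apply: (forced_meet cuv); rewrite pu pv E.
have [E|hvw] := eqVneq hw hv.
  by apply: (forced_meet cwv); rewrite pw pv E.
apply: forced_move => H HV.
case: hw => [|hw] in pw huvw hwd hn hvw *; first by lia.
have /orP[Hu|Hw] := @pos_edge2 _ _ H b i hu hw HV ltac:(lia).
  exists u, (pos b i hu.+1); rewrite pu; split=> //.
  apply: (IH _ hu.+1 hw.+1); rewrite ?upd_same ?upd_other //; first by rewrite eq_sym.
  - by rewrite eq_sym.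
  - by lia.
  - by lia.
exists w, (pos b i hw); rewrite pw; split=> //.
apply: (IH _ hu hw); rewrite ?upd_same ?upd_other //; first by rewrite eq_sym.
- by lia.
- by lia.
- by lia.
Qed.

(* Each round the agent on an uncut path moves: towards the pole [b] when its
   colour differs from that of [z], towards the other pole otherwise. An agent
   reaching the other pole encloses one of the opposite colour. *)
Lemma forced_star p b z (f : 'I_l -> T) (h : 'I_l -> nat) j :
  p z = inl b -> (forall i, 0 < h i <= d i) ->
  (forall i, p (f i) = pos b i (h i)) -> c (f j) != c z -> forced p.
Proof.
move=> pz hd pf cj.
(* Distance left to the target pole; its sum over the paths decreases every round. *)
pose goal_dist (h : 'I_l -> nat) i :=
  if c (f i) != c z then h i else (d i).+1 - h i.
have [n] := ubnP (\sum_i goal_dist h i).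
elim: n => // n IH in p h pz hd pf * => hn.
have pathf i : path_of (p (f i)) = Some i by rewrite pf path_of_pos.
have fz i : f i != z by apply/eqP => E; have := pathf i; rewrite E pz.
have finj i i' : f i = f i' -> i = i'.
  by move=> E; have := pathf i; rewrite E pathf => -[].
apply: forced_move => H HV; have Hs := HV.2.1; have [i Hi] := uncut_path HV.
have := hd i => hdi.
pose s := c (f i) != c z.
pose h1 := if s then (h i).-1 else (h i).+1.
exists (f i), (pos b i h1); rewrite pf; split.
  rewrite /h1; case: (s); last by apply: Hi; lia.
  by rewrite Hs -{2}[h i]prednK; [apply: Hi|]; lia.
have [h1d|h1d] := boolP (0 < h1 <= d i).
  pose h' i' := if i' == i then h1 else h i'.
  apply: (IH _ h').
  - by rewrite upd_other // eq_sym.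
  - by move=> i'; rewrite /h'; case: eqP => [->|].
  - move=> i'; rewrite /h'; have [->|ne] := eqVneq i' i; first by rewrite upd_same.
    by rewrite upd_other ?pf //; apply: contraNneq ne => /finj->.
  move: hn; rewrite (bigD1 i) //= [X in _ -> X < _](bigD1 i) //=.
  rewrite [X in _ -> _ + X < _](eq_bigr (goal_dist h)); last first.
    by move=> i' /negPf ne; rewrite /goal_dist /h' ne.
  rewrite /goal_dist /h' eqxx -/s /h1.
  case: (s); lia.
have [sT|sF] := boolP s.
  apply: (@forced_meet _ (f i) z) => //.
  rewrite upd_same upd_other 1?eq_sym // pz.
  have -> : h1 = 0 by move: h1d; rewrite /h1 sT; lia.
  exact: pos0.
have Ei : h1 = (d i).+1 by move: h1d; rewrite /h1 (negPf sF); lia.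
(* [f i] has reached the other pole with the colour of [z], so [f j] is on another path, enclosed by
   [z] and [f i]. *)
have ji : f j != f i by apply: contraNneq sF => E; rewrite /s -E.
have := hd j => hdj.
apply: (@forced_sandwich _ b j z (f j) (f i) 0 (h j) (d j).+1) => //.
- by rewrite upd_other 1?eq_sym // pos0.
- by rewrite upd_other.
- by rewrite upd_same Ei !pos_top.
- by lia.
- by rewrite eq_sym.
- by rewrite eq_sym.
by move: sF; rewrite negbK => /eqP ->; rewrite eq_sym.
Qed.

Definition occ p i := [exists a, path_of (p a) == Some i].

Lemma occP p i : reflect (exists a, path_of (p a) = Some i) (occ p i).
Proof.
by apply: (iffP existsP) => -[a]; [move/eqP|move=> pa]; exists a => //; apply/eqP.
Qed.

Lemma forced_all_occupied p b z y :
  p z = inl b -> (forall i, occ p i) -> c y != c z -> forced p.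
Proof.
move=> pz occp cy.
have [f pf] := choice (fun i => elimT (occP p i) (occp i)).
have star b' z' (g : 'I_l -> T) j : p z' = inl b' ->
    (forall i, path_of (p (g i)) = Some i) -> c (g j) != c z' -> forced p.
  move=> pz' pg.
  have [h hP] : {h & forall i, 0 < h i <= d i /\ p (g i) = pos b' i (h i)}.
    apply: (@choice _ _ (fun i h => 0 < h <= d i /\ p (g i) = pos b' i h)) => i.
    by have [h] := path_of_Some b' (pg i); exists h.
  by apply: (@forced_star _ b' _ _ h) => // i; case: (hP i).
(* An interior agent coloured unlike [z] can represent its path. Without one, [y] is at a pole: it
   meets [z] or plays its role at the other pole. *)
have [a /andP[]|none] := pickP (fun a => path_of (p a) && (c a != c z)).
  case pa: path_of => [j|] // _ ca.
  apply: (star b z (fun i => if i == j then a else f i) j) => //; last by rewrite eqxx.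
  by move=> i; case: eqP => [->|].
case py: (path_of (p y)) => [j|]; first by have := none y; rewrite py cy.
have [pyb|pyb] : p y = inl b \/ p y = inl (~~ b).
    by case: (b); have [] := path_of_None py => ->; auto.
  by apply: (forced_meet cy); rewrite pyb.
apply: (star (~~ b) y f (Ordinal l_gt0)) => //.
by have := none (f (Ordinal l_gt0)); rewrite pf /= => /negbFE/eqP->; rewrite eq_sym.
Qed.

(** The two agents walk apart over distinct edges, so one of them can always advance. The adversary
    decides which one leaves, hence the continuation form. *)
Lemma forced_evict p i u v :
  u != v -> path_of (p u) = Some i -> path_of (p v) = Some i ->
  (forall p', (forall a, a != u -> a != v -> p' a = p a) ->
     path_of (p' u) = None /\ path_of (p' v) = Some i \/
     path_of (p' v) = None /\ path_of (p' u) = Some i -> forced p') ->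
  forced p.
Proof.
move=> uv /(path_of_Some true)[hu hud pu] /(path_of_Some true)[hv hvd pv].
wlog huv : u v uv hu hud pu hv hvd pv / hu <= hv.
  move=> wl; case: (leqP hu hv) => [le|/ltnW le] K; first exact: (wl u v _ hu _ _ hv).
  apply: (wl v u _ hv _ _ hu) => //; first by rewrite eq_sym.
  by move=> p' Ep' side; apply: K => [a au av|]; [apply: Ep' | case: side; auto].
have [n] := ubnP (hu + ((d i).+1 - hv)).
elim: n => // n IH in p hu hv hud hvd pu pv huv * => hn K.
apply: forced_move => H HV; have Hs := HV.2.1.
case: hu => [|hu] in pu hud huv hn *; first by lia.
have /orP[Hu|Hv] := @pos_edge2 _ _ H true i hu hv HV ltac:(lia).
  exists u, (pos true i hu); rewrite pu Hs; split=> //.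
  have pv' : upd p u (pos true i hu) v = pos true i hv by rewrite upd_other // eq_sym.
  have [hu0|hu_gt0] := posnP hu.
    apply: K => [a au _|]; first by rewrite upd_other.
    by left; rewrite pv' upd_same hu0 pos0 path_of_pos.
  apply: (IH _ hu hv) => //; rewrite ?upd_same //; try lia.
  move=> p' Ep'; apply: K => a au av; by rewrite Ep' // upd_other.
exists v, (pos true i hv.+1); rewrite pv Hs; split=> //.
have pu' : upd p v (pos true i hv.+1) u = pos true i hu.+1 by rewrite upd_other.
have [hvd'|hvd'] := eqVneq hv (d i).
  apply: K => [a _ av|]; first by rewrite upd_other.
  by right; rewrite pu' upd_same hvd' pos_top path_of_pos.
apply: (IH _ hu.+1 hv.+1) => //; rewrite ?upd_same //; try lia.
move=> p' Ep'; apply: K => a au av; by rewrite Ep' // upd_other.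
Qed.

Definition empties p := [set i | ~~ occ p i].

Lemma empties_sub p p' : (forall i, occ p i -> occ p' i) -> empties p' \subset empties p.
Proof. by move=> occpp'; apply/subsetP => i; rewrite !inE; apply: contra => /occpp'. Qed.

Lemma empties_enter p i z x :
  i \in empties p -> path_of (p z) = None -> path_of x = Some i ->
  #|empties (upd p z x)| < #|empties p|.
Proof.
move=> ei pz px; apply: proper_card; rewrite properE empties_sub /=.
  apply/subsetPn; exists i => //; rewrite inE negbK; apply/occP; exists z.
  by rewrite upd_same.
move=> j /occP[a pa]; apply/occP; exists a; rewrite upd_other //.
by apply/eqP => E; rewrite E pz in pa.
Qed.

(** * Entering an empty path, with induction on the number of empty paths *)

Section FillEmptyPath.

Variable n : nat.
Hypothesis n_gt0 : 0 < n.
Hypothesis forced_lt : forall p, #|empties p| < n -> forced p.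

(** The two end edges of an empty path are distinct as [d i] is positive, so one of them is
    present. *)
Lemma forced_both_poles p b z z' :
  p z = inl b -> p z' = inl (~~ b) -> #|empties p| <= n -> forced p.
Proof.
move=> pz pz' en; have [E|[i ei]] := set_0Vmem (empties p).
  by apply: forced_lt; rewrite E cards0.
apply: forced_move => H HV; have := d_gt0 i => di.
have /orP[Hz|Hz'] := @pos_edge2 _ _ H b i 0 (d i) HV ltac:(lia).
  exists z, (pos b i 1); rewrite pz -(pos0 d b i); split=> //.
  apply: forced_lt; apply: leq_trans en; apply: empties_enter ei _ _; first by rewrite pz.
  by rewrite path_of_pos.
exists z', (pos b i (d i)); rewrite pz' -(pos_top d b i); split=> //.
apply: forced_lt; apply: leq_trans en; apply: empties_enter ei _ _; first by rewrite pz'.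
by rewrite path_of_pos // di leqnn.
Qed.

(** Distance from an interior node to the pole opposite to [b], set to 0 at both poles; summed over
    the agents, it measures the walk below. *)
Definition depth b (x : thnode d) : nat :=
  if x is inr q then if b then d (tag q) - tagged q else (tagged q).+1 else 0.

Lemma depth_pos b i h : 0 < h <= d i -> depth b (pos b i h) = (d i).+1 - h.
Proof.
have E h' : 0 < h' <= d i ->
    depth b (node i h') = if b then (d i).+1 - h' else h'.
  by case: h' => // h' /= hd; rewrite insubT.
by move=> hd; rewrite /pos E; case: (b); lia.
Qed.

(* The agent of an uncut path walks away from the pole [b]; when it leaves the
   path, [z] takes its place, and then both poles are held. *)
Lemma forced_double_pole p b z z' :
  z != z' -> p z = inl b -> p z' = inl b -> #|empties p| <= n -> forced p.
Proof.
move=> zz' pz pz' en; have [m] := ubnP (\sum_a depth b (p a)).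
elim: m => // m IH in p pz pz' en * => hm.
apply: forced_step => H HV; have [i Hi] := uncut_path HV; have := d_gt0 i => di.
have legal1 u x : H (p u) x -> forall a, legal_move H (p a) (upd p u x a).
  by move=> Hx a; rewrite /legal_move /upd; have [->|_] := eqVneq a u;
    rewrite ?Hx ?orbT ?eqxx.
have Hz : H (p z) (pos b i 1) by rewrite pz -(pos0 d b i); apply: Hi.
have [occi|ei] := boolP (occ p i); last first.
  exists (upd p z (pos b i 1)); first exact: legal1.
  apply: forced_lt; apply: leq_trans en.
  by apply: (@empties_enter _ i); rewrite ?inE ?pz ?path_of_pos.
have [v pathv] := occP _ _ occi; have [h hd pv] := path_of_Some b pathv.
have vz : v != z by apply: contraTneq isT => E; rewrite E pz in pathv.
have vz' : v != z' by apply: contraTneq isT => E; rewrite E pz' in pathv.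
have Hv : H (p v) (pos b i h.+1) by rewrite pv; apply: Hi; lia.
have [hd'|hd'] := eqVneq h (d i).
  (* [v] exits and [z] enters in the same round: path [i] stays occupied, and [z'] and [v] hold the
     two poles. *)
  exists (upd (upd p v (inl (~~ b))) z (pos b i 1)).
    move=> a; rewrite /upd; have [->|_] := eqVneq a z.
      by rewrite /legal_move Hz orbT.
    by rewrite -(pos_top d b i) -hd'; apply: legal1.
  apply: (@forced_both_poles _ b z' v).
  - by rewrite !upd_other 1?eq_sym.
  - by rewrite upd_other // upd_same.
  apply: leq_trans (subset_leq_card _) en; apply: empties_sub => j /occP[a pa].
  apply/occP; have [Ea|av] := eqVneq a v.
    exists z; rewrite upd_same path_of_pos //.
    by rewrite -pathv -Ea.
  by exists a; rewrite !upd_other //; apply: contraTneq isT => E; rewrite E pz in pa.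
exists (upd p v (pos b i h.+1)); first exact: legal1.
have hd1 : 0 < h.+1 <= d i by lia.
apply: IH; rewrite ?upd_other 1?eq_sym //.
  apply: leq_trans (subset_leq_card _) en; apply: empties_sub => j /occP[a pa].
  apply/occP; exists a; have [Ea|av] := eqVneq a v; last by rewrite upd_other.
  by rewrite Ea upd_same path_of_pos // -pathv -Ea.
move: hm; rewrite (bigD1 v) //= [X in _ -> X < _](bigD1 v) //=.
rewrite [X in _ -> _ + X < _](eq_bigr (fun a => depth b (p a))); last first.
  by move=> a av; rewrite upd_other.
by rewrite upd_same pv !depth_pos //; lia.
Qed.

End FillEmptyPath.

Definition interior p := [set a | path_of (p a) != None].

(** Lexicographic induction on the number of empty paths, then of interior agents. *)
Theorem forced_any p : l < #|T| -> (exists u v, c u != c v) -> forced p.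
Proof.
move=> lT [y [y' cy]].
have [n] := ubnP #|empties p|; elim: n => // n IHn in p *; rewrite ltnS => en.
have [m] := ubnP #|interior p|; elim: m => // m IHm in p en *; rewrite ltnS => im.
(* Evicting one of two agents on a path lowers the second measure and empties no path. *)
have [[u v] /and3P[/= uv]|inj] :=
    pickP (fun w => [&& w.1 != w.2, path_of (p w.1) != None &
                     path_of (p w.1) == path_of (p w.2)]).
  case pu: (path_of (p u)) => [i|] // _ /eqP pv.
  apply: (forced_evict uv pu (esym pv)) => p' Ep' side.
  apply: IHm.
    apply: leq_trans (subset_leq_card _) en; apply: empties_sub => j /occP[a pa].
    have [ij|ij] := eqVneq i j.
      by apply/occP; case: side => -[_ E]; [exists v | exists u]; rewrite E ij.
    apply/occP; exists a; rewrite Ep' //; apply: contraNneq ij => E;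
      move: pa; rewrite E ?pu -?pv => -[->] //.
  apply: leq_trans im; apply: proper_card; apply/properP.
  have pu' : u \in interior p by rewrite inE pu.
  have pv' : v \in interior p by rewrite inE -pv.
  split; last by case: side => -[E _]; [exists u | exists v] => //; rewrite inE E.
  apply/subsetP => a.
  have [-> //|au] := eqVneq a u; have [-> //|av] := eqVneq a v.
  by rewrite !inE Ep'.
(* Interior agents now lie on distinct nonempty paths; with more than [l] agents, those at the poles
   outnumber the empty paths. *)
have count : #|interior p| + #|empties p| <= l.
  have E : #|interior p| = #|[set path_of (p a) | a in interior p]|.
    rewrite card_in_imset // => u v; rewrite !inE => pu pv E; apply/eqP.
    by apply: contraFT (inj (u, v)) => uv; rewrite /= uv pu E eqxx.
  have sub : [set path_of (p a) | a in interior p] \subset Some @: ~: empties p.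
    apply/subsetP => o /imsetP[a]; rewrite inE; case pa: path_of => [i|] // _ ->.
    apply: imset_f; rewrite !inE negbK; apply/occP; by exists a.
  have := subset_leq_card sub; rewrite -E card_imset; last by move=> ? ? [].
  by have := cardsC (empties p); rewrite card_ord; lia.
have poles : #|empties p| < #|~: interior p|.
  by have := cardsC (interior p); lia.
have poleP z : z \in ~: interior p -> exists b, p z = inl b.
  by rewrite !inE negbK => /eqP/path_of_None[] ->; eexists.
have [e0|[i0 ei0]] := set_0Vmem (empties p).
  have /card_gt0P[z /poleP[b pz]] : 0 < #|~: interior p| by lia.
  have occp i : occ p i by have := in_set0 i; rewrite -e0 inE => /negbFE.
  have [cyz|cyz] := eqVneq (c y) (c z); last exact: (forced_all_occupied pz occp cyz).
  by apply: (@forced_all_occupied _ _ z y' pz occp); rewrite -cyz eq_sym.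
have e_gt0 : 0 < #|empties p| by apply/card_gt0P; exists i0.
have n_gt0 : 0 < n by lia.
have /card_gt1P[z [z' [/poleP[b pz] /poleP[b' pz'] zz']]] : 1 < #|~: interior p| by lia.
have IH p' : #|empties p'| < n -> forced p' by exact: IHn.
have [bb'|bb'] := eqVneq b b'.
  by rewrite -bb' in pz'; exact: (forced_double_pole n_gt0 IH zz' pz pz' en).
have pzN : p z' = inl (~~ b) by rewrite pz'; congr inl; case: b b' bb' {pz pz'} => -[].
exact: (forced_both_poles n_gt0 IH pz pzN en).
Qed.

End ForcedMeeting.

(** * From winning positions to a strategy *)

Section WinningPositions.

Variables (V : finType) (adj : rel V) (k : nat).
Implicit Types (p : agent k -> V) (I : {set agent k}) (H : rel V) (n : nat).

Definition spread p I : {set agent k} :=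
  [set a | (a \in I) || [exists b, (b \in I) && (p b == p a)]].

Definition legal H p p' := forall a, legal_move H (p a) (p' a).

Fixpoint win_in n p I : Prop :=
  I = setT \/
  if n is m.+1 then
    forall H, valid_round_graph adj H ->
      exists2 p', legal H p p' & win_in m p' (spread p' I)
  else False.

Lemma spreadT p : spread p setT = setT.
Proof. by apply/setP => a; rewrite !inE. Qed.

Lemma legal_refl H p : legal H p p.
Proof. by move=> a; rewrite /legal_move eqxx. Qed.

Lemma win_in_ext n p q I : p =1 q -> win_in n p I -> win_in n q I.
Proof.
move=> pq; case: n => [|n] //= [IT|step]; [by left | right=> H /step[p' leg w]].
by exists p' => // a; rewrite -pq.
Qed.

Lemma win_in_leq m n p I : m <= n -> win_in m p I -> win_in n p I.
Proof.
elim: m n p I => [|m IH] [|n] p I //= mn [IT|step] //; try by left.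
by right=> H /step[p' leg w]; exists p' => //; apply: IH.
Qed.

(* There are finitely many positions, hence a common bound on the length of
   the won games; this makes [win] closed under one round of play. *)
Lemma win_in_uniform :
  exists N, forall p I, (exists n, win_in n p I) -> win_in N p I.
Proof.
pose X := ({ffun agent k -> V} * {set agent k})%type.
have bound (x : X) : exists n, (exists m, win_in m x.1 x.2) -> win_in n x.1 x.2.
  have [[m w]|no] := pselect (exists m, win_in m x.1 x.2); first by exists m.
  by exists 0 => /no.
have [g gP] := choice bound.
exists (\max_x g x) => p I [n w].
apply: (@win_in_ext _ (finfun p)) => [a|]; first by rewrite ffunE.
apply: win_in_leq (leq_bigmax (finfun p, I)) _; apply: gP; exists n.
by apply: win_in_ext w => a; rewrite ffunE.
Qed.

Definition win p I := exists n, win_in n p I.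

Lemma win_step p I :
  (forall H, valid_round_graph adj H ->
     exists2 p', legal H p p' & win p' (spread p' I)) -> win p I.
Proof.
have [N NP] := win_in_uniform => step; exists N.+1; right=> H /step[p' leg w].
by exists p' => //; apply: NP.
Qed.

(** The strategy replays the history to recover the remaining rounds, the positions and the informed
    set, then answers by a choice function. *)
Lemma broadcast_of_win : (forall p, win p [set ord0]) -> broadcast_solvable adj k.
Proof.
move=> winp; have [N NP] := win_in_uniform.
pose state := (nat * (agent k -> V) * {set agent k})%type.
pose good (s : state) := win_in s.1.1 s.1.2 s.2.
pose play (s : state) p' : state := (s.1.1.-1, p', spread p' s.2).
(* Choice needs a reply in every state: outside won states and valid graphs, all agents stay. *)
have reply (sH : state * rel V) : exists p', legal sH.2 sH.1.1.2 p' /\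
    (good sH.1 -> valid_round_graph adj sH.2 -> good (play sH.1 p')).
  case: sH => -[[n p] I] H /=; rewrite /good /play /=.
  have [[w HV]|no] := pselect (win_in n p I /\ valid_round_graph adj H); last first.
    by exists p; split=> [|w HV]; [exact: legal_refl | case: no].
  case: n w => [|n] /= [->|] //.
  - by exists p; split=> [|_ _]; [exact: legal_refl | left; exact: spreadT].
  - exists p; split=> [|_ _]; [exact: legal_refl | rewrite spreadT].
    by case: n => [|n]; left.
  by move=> /(_ H HV)[p' leg w]; exists p'.
have [f fP] := choice reply.
pose next s H := play s (f (s, H)).
pose init p0 : state := (N, p0, [set ord0]).
exists (fun p0 hist => (foldl next (init p0) hist).1.2) => p0 _ A AV.
set st := (fun _ _ => _).
pose s t := foldl next (init p0) (mkseq A t).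
have sS t : s t.+1 = next (s t) (A t) by rewrite /s mkseqS foldl_rcons.
have posE t : positions st p0 A t = (s t).1.2 by case: t.
have infE t : informed st p0 A t = (s t).2.
  elim: t => //= t IH; rewrite IH sS /=; apply/setP => a.
  by rewrite !inE -[st _ _]/(positions st p0 A t.+1) posE sS.
have nE t : (s t).1.1 = N - t.
  by elim: t => [|t IH]; rewrite ?subn0 // sS /= IH subnS.
have goods t : good (s t).
  elim: t => [|t IH]; first exact/NP/winp.
  by rewrite sS; apply: (fP (s t, A t)).2 IH (AV t).
split=> [t a|]; first by rewrite !posE sS; apply: (fP (s t, A t)).1.
exists N => a; have := goods N; rewrite /good nE subnn /= => -[|//].
by rewrite infE => ->; rewrite inE.
Qed.

End WinningPositions.

(** Induction on the number of ignorant agents, coloured by membership in [I]. As [p] is arbitrary,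
    the play can restart from any placement. *)
Lemma win_theta (l : nat) (d : 'I_l -> nat) (k : nat) (p : agent k -> thnode d)
    (I : {set agent k}) :
  0 < l -> (forall i, 0 < d i) -> l <= k -> ord0 \in I -> win (@theta_adj l d) p I.
Proof.
move=> l_gt0 d_gt0 lk; have [n] := ubnP #|~: I|.
elim: n => // n IH in p I *; rewrite ltnS => cI I0.
have grow q : spread q I != I -> win (@theta_adj l d) q (spread q I).
  move=> ne; have sub : I \subset spread q I.
    by apply/subsetP => a aI; rewrite inE aI.
  apply: IH; last exact: (subsetP sub).
  by apply: leq_trans cI; apply: proper_card; rewrite properE setCS sub
    setCS; move: ne; rewrite eqEsubset sub andbT.
have [IT|[v vI]] := set_0Vmem (~: I).
  by exists 0; left; rewrite -[I]setCK IT setC0.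
have : forced (fun a => a \in I) p.
  apply: forced_any => //; first by rewrite card_ord.
  by exists ord0, v; move: vI; rewrite inE I0 => /negPf->.
elim/forced_elim: p / => [p u w uw puw|p step]; apply: win_step.
  (* The meeting agents already share a node, so standing still for a round spreads the message. *)
  move=> H _; exists p; first exact: legal_refl.
  apply: grow; apply: contraNneq uw => /setP spr.
  have := spr u; have := spr w; rewrite !inE.
  case: (boolP (u \in I)) => uI; case: (boolP (w \in I)) => wI //=.
    by move=> /existsP[]; exists u; rewrite uI puw eqxx.
  by move=> _ /existsP[]; exists w; rewrite wI puw eqxx.
move=> H /step[p' leg w]; exists p' => //.
(* If the informed set grows early, the induction restarts; otherwise the colouring is unchanged and
   the forced play continues. *)
by have [->|/grow] := eqVneq (spread p' I) I.
Qed.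

Theorem theorem1 (l : nat) (d : 'I_l -> nat) (k : nat) :
  0 < l -> (forall i, 0 < d i) -> l <= k -> k.+1 <= #|thnode d| ->
  broadcast_solvable (@theta_adj l d) k.
Proof.
move=> l_gt0 d_gt0 lk _; apply: broadcast_of_win => p.
by apply: win_theta; rewrite ?inE.
Qed.
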